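(* Let $d\ge 1$ and let $p,q\ge 0$ be integers with $2p+q=d$. Let $\mathbf P\in\mathbb R^{d\times d}$ be an orthogonal matrix and let $\alpha_1,\ldots,\alpha_p\in\mathbb R$. For $s\in\mathbb Z$ define $$\mathbf W_s=\mathbf P^{\mathsf T}\mathbf\Lambda^{(s)}\mathbf P,\qquad \mathbf\Lambda^{(s)}=\text{block-diag}\{\mathbf A^{(s)},\mathbf B^{(s)}\},$$ $$\mathbf A^{(s)}=\text{block-diag}\{\mathbf A_1^{(s)},\ldots,\mathbf A_p^{(s)}\}\in\mathbb R^{2p\times 2p},\qquad \mathbf B^{(s)}=\mathbf I_q\in\mathbb R^{q\times q},$$ $$\mathbf A_k^{(s)}=\begin{bmatrix}\cos(s\alpha_k)&-\sin(s\alpha_k)\\ \sin(s\alpha_k)&\cos(s\alpha_k)\end{bmatrix},\quad k=1,\ldots,p.$$ Then $\mathbf W_{t-s}=\mathbf W_s^{\mathsf H}\mathbf W_t$ for all $s,t\in\mathbb Z$.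
   Context: $\mathsf H$ denotes conjugate transposition, which for real matrices is the transpose $\mathsf T$. $\text{block-diag}\{\cdot\}$ denotes the block diagonal matrix with the listed square blocks along the diagonal, and $\mathbf I_q$ is the $q\times q$ identity matrix. *)

(* Defs.v *)
From mathcomp Require Import all_boot all_order all_algebra.
From mathcomp Require Import reals trigo.

Set Implicit Arguments.
Unset Strict Implicit.
Unset Printing Implicit Defensive.

Import Order.TTheory GRing.Theory Num.Theory.
Local Open Scope ring_scope.

Definition orthogonal_mx (R : realType) (n : nat) (P : 'M[R]_n) : Prop :=
  P^T *m P = 1%:M /\ P *m P^T = 1%:M.

Definition rotation_mx (R : realType) (x : R) : 'M[R]_2 :=
  \matrix_(i < 2, j < 2)
    if i == 0 then (if j == 0 then cos x else - sin x)
    else (if j == 0 then sin x else cos x).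

Lemma sum_2_ord (p : nat) : (\sum_(k < p) 2 = 2 * p)%N.
Proof. by rewrite sum_nat_const card_ord mulnC. Qed.

(* [\mxdiag_(k < p)] of 2 x 2 blocks has the size [\sum_(k < p) 2]; the cast
   only relabels that size as [2 * p]. *)
Definition A_mx (R : realType) (p : nat) (alpha : 'I_p -> R) (s : int) :
    'M[R]_(2 * p) :=
  castmx (sum_2_ord p, sum_2_ord p)
    (\mxdiag_(k < p) rotation_mx (s%:~R * alpha k)).

Definition B_mx (R : realType) (q : nat) (s : int) : 'M[R]_q := 1%:M.

Definition Lambda_mx (R : realType) (p q : nat) (alpha : 'I_p -> R) (s : int) :
    'M[R]_(2 * p + q) :=
  block_mx (A_mx alpha s) 0 0 (B_mx R q s).

Definition W_mx (R : realType) (d p q : nat) (hd : (2 * p + q = d)%N)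
    (P : 'M[R]_d) (alpha : 'I_p -> R) (s : int) : 'M[R]_d :=
  P^T *m castmx (hd, hd) (Lambda_mx q alpha s) *m P.

(* Main.v *)
Require Import Defs.
From mathcomp Require Import all_boot all_order all_algebra.
From mathcomp Require Import reals trigo.
Import Order.TTheory GRing.Theory Num.Theory.
Local Open Scope ring_scope.

(** Since [P *m P^T = 1], the inner factors of [W_s^T *m W_t] cancel, leaving the conjugate by [P]
    of [Lambda_s^T *m Lambda_t]. That product is computed block by block: identity blocks are fixed,
    and for plane rotations the transpose reverses the angle, so angles subtract ([rotation_mxB]).
    The casts on sizes commute with all of this. *)

Lemma trmx_castmx_mul (R : pzSemiRingType) (m n : nat) (e : m = n)
    (A B : 'M[R]_m) :
  (castmx (e, e) A)^T *m castmx (e, e) B = castmx (e, e) (A^T *m B).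
Proof. by case: n / e; rewrite !castmx_id. Qed.

Lemma mul_mxdiag_mxdiag (R : pzSemiRingType) (p : nat) (p_ : 'I_p -> nat)
    (A B : forall i, 'M[R]_(p_ i)) :
  \mxdiag_i A i *m \mxdiag_i B i = \mxdiag_i (A i *m B i).
Proof.
(* With only the right factor seen as a general block matrix, the left one multiplies its block
   rows, so no sum over blocks appears. *)
rewrite [X in _ *m X]/mxdiag mul_mxdiag_mxblock; apply/eq_mxblock => i j.
by case: eqVneq => [->|_]; rewrite ?conform_mx_id // mulmx0.
Qed.

(** The four entries are the subtraction formulas for [cos] and [sin]. *)
Lemma rotation_mxB (R : realType) (x y : R) :
  rotation_mx (y - x) = (rotation_mx x)^T *m rotation_mx y.
Proof.
apply/matrixP=> i j; rewrite !mxE big_ord_recl big_ord1 !mxE /= sinB cosB.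
by case: (i == 0); case: (j == 0); rewrite /= ?mulrN ?mulNr ?opprB ?opprK
   1?[cos y * _]mulrC 1?[sin y * _]mulrC // addrC.
Qed.

Lemma A_mxB (R : realType) (p : nat) (alpha : 'I_p -> R) (s t : int) :
  A_mx alpha (t - s) = (A_mx alpha s)^T *m A_mx alpha t.
Proof.
rewrite /A_mx trmx_castmx_mul tr_mxdiag mul_mxdiag_mxdiag; congr castmx.
by apply/eq_mxdiag => k; rewrite -rotation_mxB intrB mulrBl.
Qed.

Lemma Lambda_mxB (R : realType) (p q : nat) (alpha : 'I_p -> R) (s t : int) :
  Lambda_mx q alpha (t - s) = (Lambda_mx q alpha s)^T *m Lambda_mx q alpha t.
Proof.
rewrite /Lambda_mx /B_mx tr_block_mx mulmx_block !trmx0 trmx1 -A_mxB.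
by rewrite !mulmx0 !mul0mx mulmx1 !addr0 add0r.
Qed.

Theorem proposition3p4 (R : realType) (d p q : nat) (hd1 : (1 <= d)%N)
    (hd : (2 * p + q = d)%N) (P : 'M[R]_d) (hP : orthogonal_mx P)
    (alpha : 'I_p -> R) :
  forall s t : int,
    W_mx hd P alpha (t - s) = (W_mx hd P alpha s)^T *m W_mx hd P alpha t.
Proof.
move=> s t; have [_ PPT] := hP.
rewrite /W_mx Lambda_mxB -trmx_castmx_mul !trmx_mul trmxK !mulmxA.
(* Reassociating isolates the inner [P *m P^T], where orthogonality applies. *)
by rewrite -(mulmxA _ P P^T) PPT mulmx1.
Qed.
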